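(* The component $I_k\subset I$ parametrizes all pairs of equivalence classes $(x,x')$ (signals modulo global phase) such that there exist vectors $x_1\in\mathbb{C}^{k+1}$ and $x_2\in\mathbb{C}^{N-k+1}$ such that $x=x_1\star x_2$ and $x'=x_1\star\dot{x_2}$.
   Context: For $x\in\mathbb{C}^{N+1}$ let $\hat{x}(\omega)=\sum_{n=0}^Nx[n]\omega^n$, $\omega\in S^1$ (the unit circle). Signals have full support ($x[0],x[N]\neq0$). $X=(\mathbb{C}^\times\times\mathbb{C}^{N-1}\times\mathbb{C}^\times)/S^1$ is the space of signals modulo multiplication by unit complex scalars (global phase). $I\subset X\times X$ is the set of pairs $(x,x')$ with $|\hat{x}(\omega)|^2=|\hat{x'}(\omega)|^2$. It decomposes into $N+1$ connected irreducible components $I_0,\dots,I_N$, obtained as follows. Let $\tilde{X}=\mathbb{R}_{>0}\times(\mathbb{C}^\times)^N$ and let $\tilde{\Phi}:\tilde{X}\to X$ send $(a_0,\beta_1,\dots,\beta_N)$ to the class of the signal with Fourier transform $a_0\prod_{i=1}^N(\omega-\beta_i)$. For $S\subset\{1,\dots,N\}$ let $\tilde{I}_S\subset\tilde{X}\times\tilde{X}$ be the set of pairs $((a_0,\beta_1,\dots,\beta_N),(a_0',\beta_1',\dots,\beta_N'))$ such that $\beta_i'=\overline{\beta_i}^{-1}$ for $i\in S$, $\beta_i'=\beta_i$ for $i\notin S$, and the images of the two points under $\tilde{\Phi}$ have the same Fourier intensity function. The component $I_k$ is the image of $\tilde{I}_S$ in $I$ under $\tilde{\Phi}\times\tilde{\Phi}$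 for any $S$ with $|S|=k$; the image depends only on $|S|$. For a vector $y\in\mathbb{C}^{m+1}$, $\dot{y}\in\mathbb{C}^{m+1}$ is obtained from $y$ by reflection and conjugation, $\dot{y}[n]=\overline{y[m-n]}$. For $x_1\in\mathbb{C}^{k+1}$ and $x_2\in\mathbb{C}^{N-k+1}$, the convolution $x_1\star x_2\in\mathbb{C}^{N+1}$ is $(x_1\star x_2)[n]=\sum_{\ell=0}^{k}x_1[\ell]\,\overline{x_2[n-\ell]}$, where vectors are extended by zero outside their index range.
   Formalization: The printed claim has k and N−k interchanged (false for N=1, k=0, x1=(1), x2=(1,2)); the theorem proved says that the component I_{N−k}, in which N−k roots are reflected, consists of the pairs given by x1 in C^{k+1} and x2 in C^{N−k+1}. *)

(* Defs.v *)
From HB Require Import structures.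
From mathcomp Require Import all_boot all_order all_algebra.
From mathcomp Require Import generic_quotient.
From mathcomp Require Import complex.
From mathcomp Require Import boolp classical_sets reals.

Set Implicit Arguments.
Unset Strict Implicit.
Unset Printing Implicit Defensive.
Import Order.TTheory GRing.Theory Num.Theory.
Local Open Scope ring_scope.
Local Open Scope complex_scope.
Local Open Scope classical_set_scope.
Local Open Scope quotient_scope.

Definition dtft (R : realType) (m : nat) (x : 'rV[R[i]]_m) (w : R[i]) : R[i] :=
  \sum_(n < m) x 0 n * w ^+ n.

Definition signal (R : realType) (N : nat) : Type :=
  {x : 'rV[R[i]]_N.+1 | (x 0 ord0 != 0) && (x 0 ord_max != 0)}.

Definition phase_rel (R : realType) (N : nat) : rel (signal R N) :=
  fun x y => `[< exists u : R[i], `|u| = 1 /\ val y = u *: val x >].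

Lemma phase_rel_refl (R : realType) (N : nat) : reflexive (@phase_rel R N).
Proof. by move=> x; apply/asboolP; exists 1; rewrite normr1 scale1r. Qed.

Lemma phase_rel_sym (R : realType) (N : nat) : symmetric (@phase_rel R N).
Proof.
have H (x y : signal R N) : phase_rel x y -> phase_rel y x.
  move=> /asboolP [u [u1 e]]; apply/asboolP; exists u^-1.
  have u0 : u != 0 by rewrite -normr_eq0 u1 oner_eq0.
  by rewrite normfV u1 invr1 e scalerA mulVf // scale1r.
by move=> x y; apply/idP/idP; apply: H.
Qed.

Lemma phase_rel_trans (R : realType) (N : nat) : transitive (@phase_rel R N).
Proof.
move=> y x z /asboolP [u [u1 eu]] /asboolP [v [v1 ev]]; apply/asboolP.
by exists (v * u); rewrite normrM u1 v1 mulr1 ev eu scalerA.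
Qed.

Canonical phase_equiv (R : realType) (N : nat) :=
  EquivRel (@phase_rel R N) (@phase_rel_refl R N) (@phase_rel_sym R N)
    (@phase_rel_trans R N).

Definition sigX (R : realType) (N : nat) := {eq_quot (phase_equiv R N)}.

Definition intensity (R : realType) (N : nat) (c : sigX R N) (w : R[i]) : R[i] :=
  `|dtft (val (repr c)) w| ^+ 2.

Lemma intensity_pi (R : realType) (N : nat) (x : signal R N) (w : R[i]) :
  intensity (\pi_(sigX R N) x) w = `|dtft (val x) w| ^+ 2.
Proof.
rewrite /intensity.
have /eqmodP/asboolP[u [u1 ->]] : x = repr (\pi_(sigX R N) x) %[mod sigX R N].
  by rewrite reprK.
have -> : dtft (u *: val x) w = u * dtft (val x) w.
  by rewrite /dtft mulr_sumr; apply: eq_bigr => n _; rewrite mxE mulrA.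
by rewrite normrM u1 mul1r.
Qed.

Definition Iset (R : realType) (N : nat) : set (sigX R N * sigX R N) :=
  [set q | forall w : R[i], `|w| = 1 -> intensity q.1 w = intensity q.2 w].

Definition Xtilde (R : realType) (N : nat) : Type :=
  ({a : R | 0 < a} * ('I_N -> {z : R[i] | z != 0}))%type.

Definition lead (R : realType) (N : nat) (p : Xtilde R N) : R := val p.1.
Definition beta (R : realType) (N : nat) (p : Xtilde R N) (i : 'I_N) : R[i] :=
  val (p.2 i).

Definition root_poly (R : realType) (N : nat) (p : Xtilde R N) : {poly R[i]} :=
  (lead p)%:C *: \prod_(i < N) ('X - (beta p i)%:P).

Lemma lead_neq0 (R : realType) (N : nat) (p : Xtilde R N) : (lead p)%:C != 0.
Proof.
by rewrite fmorph_eq0; apply: lt0r_neq0; exact: (valP p.1).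
Qed.

Lemma size_root_poly (R : realType) (N : nat) (p : Xtilde R N) :
  size (root_poly p) = N.+1.
Proof.
by rewrite size_scale ?lead_neq0 // size_prod_XsubC /index_enum unlock -enumT size_enum_ord.
Qed.

Lemma root_vec_support (R : realType) (N : nat) (p : Xtilde R N) :
  ((poly_rV (root_poly p) : 'rV_N.+1) 0 ord0 != 0) &&
  ((poly_rV (root_poly p) : 'rV_N.+1) 0 ord_max != 0).
Proof.
apply/andP; split; rewrite mxE /=.
  rewrite -horner_coef0 hornerZ horner_prod mulf_neq0 ?lead_neq0 //.
  apply/prodf_neq0 => i _; rewrite hornerXsubC sub0r oppr_eq0.
  exact: (valP (p.2 i)).
have : lead_coef (root_poly p) != 0.
  by rewrite lead_coef_eq0 -size_poly_eq0 size_root_poly.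
by rewrite lead_coefE size_root_poly.
Qed.

Definition root_signal (R : realType) (N : nat) (p : Xtilde R N) : signal R N :=
  exist _ (poly_rV (root_poly p)) (root_vec_support p).

Lemma dtft_root_signal (R : realType) (N : nat) (p : Xtilde R N) (w : R[i]) :
  dtft (val (root_signal p)) w = (lead p)%:C * \prod_(i < N) (w - beta p i).
Proof.
transitivity (root_poly p).[w].
  rewrite (@horner_coef_wide _ N.+1) ?size_root_poly // /dtft.
  by apply: eq_bigr => n _; rewrite mxE.
by rewrite hornerZ horner_prod; congr (_ * _); apply: eq_bigr => i _;
  rewrite hornerXsubC.
Qed.

Definition Phi (R : realType) (N : nat) (p : Xtilde R N) : sigX R N :=
  \pi_(sigX R N) (root_signal p).

Definition Itilde (R : realType) (N : nat) (S : {set 'I_N}) :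
    set (Xtilde R N * Xtilde R N) :=
  [set q | [/\ forall i, i \in S -> beta q.2 i = ((beta q.1 i)^*)^-1,
               forall i, i \notin S -> beta q.2 i = beta q.1 i
             & Iset (Phi q.1, Phi q.2)]].

(* This is I_j with j = #|S|, the number of reflected roots.  Passing from
   conv N x1 x2 to conv N x1 (reflect_conj x2), with x2 of length m.+1, reflects
   the m roots coming from x2, so such pairs lie in I_m. *)
Definition component (R : realType) (N : nat) (S : {set 'I_N}) :
    set (sigX R N * sigX R N) :=
  [set (Phi q.1, Phi q.2) | q in @Itilde R N S].

Definition reflect_conj (R : realType) (m : nat) (y : 'rV[R[i]]_m.+1) :
    'rV[R[i]]_m.+1 :=
  \row_n (y 0 (rev_ord n))^*.

Definition zero_ext (R : realType) (m : nat) (y : 'rV[R[i]]_m) (n : nat) : R[i] :=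
  oapp (fun j : 'I_m => y 0 j) 0 (insub n).

(* The second factor is conjugated.  Terms with l > n vanish in the sum defining
   the convolution; they are filtered out because n - l is truncated on nat.
   The length N of the result is a parameter so that the lengths k and N - k of
   the factors need no cast; nothing is cut off when k + m <= N. *)
Definition conv (R : realType) (N k m : nat)
    (x1 : 'rV[R[i]]_k.+1) (x2 : 'rV[R[i]]_m.+1) : 'rV[R[i]]_N.+1 :=
  \row_(n < N.+1)
    \sum_(l < k.+1 | (l <= n)%N) x1 0 l * (zero_ext x2 (n - l)%N)^*.

(* Main.v *)
(** In terms of polynomials, [conv N x1 x2] is the product [P * Q] of
    [P = rVpoly x1] and the coefficientwise conjugate [Q] of [rVpoly x2], and
    replacing [x2] by [reflect_conj x2] replaces [Q] by its conjugate reciprocal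
    [X^m * conj(Q)(1/X)], [m = N - k].  This operation inverts and conjugates
    the roots of [Q] and keeps [|Q|] unchanged on the unit circle.  So splitting
    the roots of a signal into those in [S] (the factor [Q]) and those outside
    [S] (the factor [P]) matches the two descriptions.  What remains is a
    constant factor between signals with the same roots; it has modulus [1]
    because the intensities agree at some point of the circle where they do not
    vanish. *)
Require Import Defs.
From mathcomp Require Import all_boot all_order all_algebra.
From mathcomp Require Import generic_quotient complex.
From mathcomp Require Import boolp classical_sets reals.
From mathcomp Require Import zify.

Set Implicit Arguments.
Unset Strict Implicit.
Unset Printing Implicit Defensive.
Import Order.TTheory GRing.Theory Num.Theory.
Local Open Scope ring_scope.

(** * Nonvanishing of polynomials on the unit circle *)

Lemma exists_unit_circle_nonroot (C : numClosedFieldType) (p : {poly C}) :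
  p != 0 -> exists w : C, `|w| = 1 /\ p.[w] != 0.
Proof.
move=> p0.
(* The Cayley transform gives infinitely many points of the unit circle. *)
pose z (t : nat) : C := 1 + 'i * t%:R.
have Re_z t : 'Re (z t) = 1 by rewrite Re_rect ?rpred1 ?realn.
have Im_z t : 'Im (z t) = t%:R by rewrite Im_rect ?rpred1 ?realn.
have z0 t : z t != 0.
  by apply/eqP => /(congr1 (fun x => 'Re x)) /eqP; rewrite Re_z raddf0 oner_eq0.
have zc0 t : (z t)^* != 0 by rewrite conjC_eq0.
pose w t := z t / (z t)^*.
have winj : injective w.
  (* Cross-multiplying [w s = w t] says that [z s * (z t)^*] equals its own conjugate; comparing
     imaginary parts gives [s - t = t - s]. *)
  move=> s t /eqP; rewrite /w eqr_div // => /eqP /(congr1 (fun x => 'Im x)).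
  rewrite !ImM !Re_conj !Im_conj !Re_z !Im_z !mul1r => /eqP.
  rewrite addrC [eqbRHS]addrC -[eqbRHS]opprB -subr_eq0 opprK -mulr2n.
  by rewrite mulrn_eq0 /= subr_eq0 eqr_nat => /eqP.
have /negP/allPn : ~ all (root p) [seq w t | t <- iota 0 (size p)].
  move=> roots; have := max_poly_roots p0 roots.
  by rewrite map_inj_uniq // iota_uniq size_map size_iota ltnn => /(_ isT).
case=> v /mapP[t _ ->] nroot; exists (w t); split=> //.
by rewrite /w normrM normfV norm_conjC divff // normr_eq0.
Qed.

(** * Conjugate reciprocal polynomials *)

(** The reversal is relative to [m], not to the degree of [p], to match the reversal of a vector of
    length [m.+1] whose last entries may vanish. *)
Definition conj_recip (C : numClosedFieldType) (m : nat) (p : {poly C}) : {poly C} :=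
  \poly_(i < m.+1) (p`_(m - i))^*.

Lemma conj_recipZ (C : numClosedFieldType) (m : nat) (c : C) (p : {poly C}) :
  conj_recip m (c *: p) = c^* *: conj_recip m p.
Proof.
apply/polyP => i; rewrite coefZ !coef_poly coefZ rmorphM.
by case: ifP => _ //; rewrite mulr0.
Qed.

Lemma conj_recip_mulXsubC (C : numClosedFieldType) (m : nat) (b : C) (p : {poly C}) :
  (size p <= m.+1)%N ->
  conj_recip m.+1 (('X - b%:P) * p) = (1 - b^* *: 'X) * conj_recip m p.
Proof.
move=> sp; apply/polyP => i.
rewrite !mulrBl mul1r -scalerAl coefB coefZ coefXM !coef_poly.
rewrite coefB coefXM coefCM rmorphB rmorphM /=.
case: i => [|i] /=.
  (* The constant coefficient is where the size bound enters: [p] must have no term of degree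
     [m.+1]. *)
  by rewrite !subn0 [p`_m.+1]nth_default // rmorph0 !mulr0 !subr0.
rewrite !ltnS subSS subn_eq0.
have [lt_im|gt_im|->] := ltngtP i m.
- by rewrite subnS.
- by rewrite mulr0 subr0.
by rewrite rmorph0 !sub0r.
Qed.

(** With [c] the conjugate of [b i], each factor reverses to [1 - c X = - c (X - c^-1)], which
    produces both the inverted root and the constant. *)
Lemma conj_recip_prod (C : numClosedFieldType) (I : Type) (s : seq I) (b : I -> C) :
  (forall i, b i != 0) ->
  conj_recip (size s) (\prod_(i <- s) ('X - (b i)%:P)) =
  (\prod_(i <- s) - (b i)^*) *: \prod_(i <- s) ('X - (((b i)^*)^-1)%:P).
Proof.
move=> b0; elim: s => [|i s IH] /=.
  rewrite !big_nil scale1r; apply/polyP => -[|i]; rewrite coef_poly !coef1 //.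
  by rewrite rmorph1.
rewrite !big_cons conj_recip_mulXsubC ?size_prod_XsubC // IH.
rewrite -scalerAr [- (b i)^* * _]mulrC -scalerA; congr (_ *: _).
rewrite scalerAl; congr (_ * _).
rewrite scalerBr scaleNr scale_polyC mulNr mulfV ?conjC_eq0 //.
by rewrite polyCN opprK addrC.
Qed.

(** On the unit circle [w^-1] is the conjugate of [w], so the value at [w] is [w ^+ m] times the
    conjugate of [p.[w]]. *)
Lemma norm_horner_conj_recip (C : numClosedFieldType) (m : nat) (p : {poly C}) (w : C) :
  (size p <= m.+1)%N -> `|w| = 1 -> `|(conj_recip m p).[w]| = `|p.[w]|.
Proof.
move=> sp w1; have w0 : w != 0 by rewrite -normr_eq0 w1 oner_eq0.
have -> : (conj_recip m p).[w] = w ^+ m * (p.[w])^*.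
  rewrite horner_poly (horner_coef_wide _ sp) rmorph_sum mulr_sumr.
  rewrite [LHS](reindex_inj rev_ord_inj) /=; apply: eq_bigr => i _.
  have im : (i <= m)%N by rewrite -ltnS.
  rewrite subSS subKn // rmorphM rmorphXn /= mulrCA; congr (_ * _).
  have -> : w^* = w^-1 by rewrite invC_norm w1 expr1n invr1 mul1r.
  by rewrite exprVn -exprB ?unitfE.
by rewrite normrM normrX w1 expr1n mul1r norm_conjC.
Qed.

(** * Signals and convolutions as polynomials *)

Lemma rVpoly_conv (R : realType) (N k m : nat)
    (x1 : 'rV[R[i]]_k.+1) (x2 : 'rV[R[i]]_m.+1) :
  (k + m)%N = N ->
  rVpoly (conv N x1 x2) = rVpoly x1 * map_poly Num.conj (rVpoly x2).
Proof.
move=> kmN; have zero_extE n : zero_ext x2 n = (rVpoly x2)`_n.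
  by rewrite coef_rVpoly /zero_ext; case: insub.
have size_rVpoly d (u : 'rV[R[i]]_d) : (size (rVpoly u) <= d)%N.
  exact: size_poly.
apply/polyP => n; rewrite coef_rVpoly.
case: insubP => [j lt_jN <-|].
  rewrite mxE coefM.
  under eq_bigr => l _ do
    rewrite zero_extE -coef_map -(coef_rVpoly_ord x1).
  pose F l := (rVpoly x1)`_l * (map_poly Num.conj (rVpoly x2))`_(j - l).
  have le_kN : (k.+1 <= N.+1)%N by rewrite ltnS -kmN leq_addr.
  (* Both sums are widened to [l < N.+1]; the extra terms on the right have [l > k], beyond the size
     of [rVpoly x1]. *)
  rewrite (big_ord_widen_cond _ (fun l => l <= j)%N F le_kN).
  rewrite [RHS](big_ord_widen _ F (ltn_ord j)).
  rewrite [RHS](bigID (fun l : 'I_N.+1 => l < k.+1)%N) /=.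
  rewrite [X in _ = _ + X]big1 ?addr0 // => l /andP[_]; rewrite -leqNgt => le_kl.
  by rewrite /F nth_default ?mul0r // (leq_trans (size_rVpoly _ _)).
rewrite -leqNgt => le_Nn; rewrite nth_default //.
apply: leq_trans le_Nn; apply: leq_trans (size_polyMleq _ _) _.
rewrite size_map_poly -kmN -ltnS.
have := leq_add (size_rVpoly _ x1) (size_rVpoly _ x2).
rewrite addSn addnS; case: (_ + _)%N => //=.
Qed.

Lemma conj_rVpoly_reflect_conj (R : realType) (m : nat) (x : 'rV[R[i]]_m.+1) :
  map_poly Num.conj (rVpoly (reflect_conj x)) =
  conj_recip m (map_poly Num.conj (rVpoly x)).
Proof.
apply/polyP => n; rewrite coef_map coef_rVpoly /conj_recip coef_poly.
case: insubP => [j lt_jm <-|/negPf ->]; last exact: rmorph0.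
by rewrite ltn_ord mxE coef_map -(coef_rVpoly_ord x) /= subSS.
Qed.

Lemma dtft_rVpoly (R : realType) (m : nat) (x : 'rV[R[i]]_m) (w : R[i]) :
  dtft x w = (rVpoly x).[w].
Proof.
rewrite (@horner_coef_wide _ m) ?size_poly //.
by apply: eq_bigr => i _; rewrite coef_rVpoly_ord.
Qed.

Lemma rVpoly_root_signal (R : realType) (N : nat) (p : Xtilde R N) :
  rVpoly (val (root_signal p)) = root_poly p.
Proof. by rewrite poly_rV_K ?size_root_poly. Qed.

(** Positivity of the leading coefficient costs nothing modulo phase: [lead p] is the modulus of
    [c], and the remaining factor of [c] has modulus one. The nonzero entry [x[0]] forces [c] and
    every root to be nonzero. *)
Lemma factored_signalP (R : realType) (N : nat) (x : signal R N) (c : R[i])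
    (b : 'I_N -> R[i]) :
  rVpoly (val x) = c *: \prod_i ('X - (b i)%:P) ->
  exists p : Xtilde R N, beta p =1 b /\ Phi p = \pi_(sigX R N)%qT x.
Proof.
move=> xE; have /andP[x0 _] := valP x.
move: x0; rewrite -(coef_rVpoly_ord (val x)) xE -horner_coef0 hornerZ horner_prod.
rewrite mulf_eq0 negb_or => /andP[c0 /prodf_neq0 b0].
have {}b0 i : b i != 0.
  by have := b0 i isT; rewrite hornerXsubC sub0r oppr_eq0.
have c_gt0 : 0 < complex.Re `|c|.
  by rewrite -ltcR RRe_real ?normr_real // normr_gt0.
pose p : Xtilde R N := (exist (fun a : R => 0 < a) _ c_gt0,
  fun i => exist (fun z : R[i] => z != 0) _ (b0 i)).
have leadE : (lead p)%:C%C = `|c| by exact: (RRe_real (normr_real c)).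
exists p; split=> //.
apply/eqmodP/asboolP; exists (c / `|c|); split.
  by rewrite normrM normfV normr_id divff // normr_eq0.
apply: (can_inj rVpolyK); rewrite xE linearZ /= rVpoly_root_signal /root_poly.
rewrite scalerA; congr (_ *: _).
by rewrite leadE divfK // normr_eq0.
Qed.

(** * Distributing roots over an index set and its complement *)

Lemma exists_map_enum (T : Type) (I : finType) (A : {set I}) (s t : seq T) :
  size s = #|A| -> size t = #|~: A| ->
  exists f : I -> T, map f (enum A) = s /\ map f (enum (~: A)) = t.
Proof.
(* The default for [nth] is taken from the lists themselves; if both are empty, so is [I], and a
   function exists vacuously. *)
case st_eq: (s ++ t) => [|x0 st] szs szt.
  have /eqP := congr1 size st_eq.
  rewrite size_cat szs szt cardsC => /eqP I0.
  have f (i : I) : T by have := card0_eq I0 i.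
  exists f; move: szs szt; rewrite !cardE.
  by case: s t st_eq {I0} => [|? ?] [|? ?] //= _ /esym/size0nil -> /esym/size0nil ->.
have nth_enum (B : {set I}) (u : seq T) :
    size u = #|B| -> map (fun i => nth x0 u (index i (enum B))) (enum B) = u.
  move=> szu; apply: (@eq_from_nth _ x0); rewrite size_map -cardE // => n ltn.
  have [i0 _] : exists i0, i0 \in B by apply/card_gt0P; apply: leq_ltn_trans ltn.
  by rewrite (nth_map i0) -?cardE // index_uniq -?cardE ?enum_uniq.
exists (fun i => if i \in A then nth x0 s (index i (enum A))
                 else nth x0 t (index i (enum (~: A)))).
split; [rewrite -[RHS](nth_enum A) //|rewrite -[RHS](nth_enum (~: A)) //];
  apply/eq_in_map => i; rewrite mem_enum ?inE; first by move=> ->.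
by move/negPf => ->.
Qed.

Lemma prod_enum_setC (R : comNzRingType) (I : finType) (A : {set I}) (F : I -> R) :
  \prod_i F i = \prod_(i <- enum (~: A)) F i * \prod_(i <- enum A) F i.
Proof.
rewrite !big_enum mulrC (bigID (mem A)) /=; congr (_ * _).
by apply: eq_bigl => i; rewrite inE.
Qed.

(** Both inclusions use this to identify the second signal: reversing the factor over [A] reflects
    exactly the roots indexed by [A]. *)
Lemma mul_conj_recip_prod (C : numClosedFieldType) (I : finType) (A : {set I})
    (b b' : I -> C) (c : C) :
  (forall i, b i != 0) ->
  (forall i, i \in A -> b' i = ((b i)^*)^-1) ->
  (forall i, i \notin A -> b' i = b i) ->
  \prod_(i <- enum (~: A)) ('X - (b i)%:P) *
    conj_recip #|A| (c *: \prod_(i <- enum A) ('X - (b i)%:P)) =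
  (c^* * \prod_(i <- enum A) - (b i)^*) *: \prod_i ('X - (b' i)%:P).
Proof.
move=> b0 bA bAC.
rewrite conj_recipZ cardE conj_recip_prod // scalerA -scalerAr; congr (_ *: _).
rewrite (prod_enum_setC A).
congr (_ * _); apply: eq_big_seq => i; rewrite mem_enum ?inE => Ai.
  by rewrite bAC.
by rewrite bA.
Qed.

Local Open Scope complex_scope.
Local Open Scope classical_set_scope.
Local Open Scope quotient_scope.

(** * The two inclusions *)

Lemma component_sub_conv (R : realType) (N k : nat) (hk : (k <= N)%N)
    (S : {set 'I_N}) (hS : #|S| = (N - k)%N) (p p' : Xtilde R N) :
  Itilde S (p, p') ->
  exists (x x' : signal R N)
         (x1 : 'rV[R[i]]_k.+1) (x2 : 'rV[R[i]]_(N - k).+1),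
    [/\ (Phi p, Phi p') = (\pi_(sigX R N) x, \pi_(sigX R N) x'),
        val x = conv N x1 x2
      & val x' = conv N x1 (reflect_conj x2)].
Proof.
case=> /= bS bSC int.
have kmN : (k + (N - k))%N = N by rewrite subnKC.
have hSC : #|~: S| = k by rewrite cardsCs finset.setCK hS card_ord subKn.
have b0 i : beta p i != 0 by exact: (valP (p.2 i)).
set P : {poly R[i]} := \prod_(i <- enum (~: S)) ('X - (beta p i)%:P).
pose Q : {poly R[i]} := (lead p)%:C *: \prod_(i <- enum S) ('X - (beta p i)%:P).
have sP : (size P <= k.+1)%N by rewrite size_prod_XsubC -cardE hSC.
have sQ : (size Q <= (N - k).+1)%N.
  by rewrite size_scale ?lead_neq0 // size_prod_XsubC -cardE hS.
pose x1 : 'rV[R[i]]_k.+1 := poly_rV P.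
(* The coefficients of [Q] are conjugated here because [conv] conjugates its second argument. *)
pose x2 : 'rV[R[i]]_(N - k).+1 := poly_rV (map_poly Num.conj Q).
have x1E : rVpoly x1 = P by rewrite poly_rV_K.
have x2E : map_poly Num.conj (rVpoly x2) = Q.
  rewrite poly_rV_K ?size_map_poly // -map_poly_comp map_poly_id // => z _.
  exact: conjCK.
have PQ : P * Q = root_poly p.
  by rewrite -scalerAr /root_poly (prod_enum_setC S).
set c := (((lead p)%:C)^*%R * \prod_(i <- enum S) - ((beta p i)^*)%R) / (lead p')%:C.
have PQ' : P * conj_recip (N - k) Q = c *: root_poly p'.
  by rewrite -hS (mul_conj_recip_prod _ b0 bS bSC) scalerA divfK ?lead_neq0.
have norm_c : `|c| = 1.
  have p'0 : root_poly p' != 0 by rewrite -size_poly_eq0 size_root_poly.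
  have [w [w1 p'w0]] := exists_unit_circle_nonroot p'0.
  have := int w w1; rewrite /= !intensity_pi !dtft_rVpoly !rVpoly_root_signal.
  move=> /eqP; rewrite eqrXn2 // => /eqP.
  rewrite -PQ hornerM normrM -(norm_horner_conj_recip sQ w1) -normrM -hornerM PQ'.
  rewrite hornerZ normrM => e; apply: (mulIf (x := `|(root_poly p').[w]|)).
    by rewrite normr_eq0.
  by rewrite mul1r.
have c0 : c != 0 by rewrite -normr_eq0 norm_c oner_eq0.
(* The convolution gives [c] times [root_signal p'], so this multiple is taken as the representative
   of [Phi p']. *)
have x'P : ((c *: val (root_signal p')) 0 ord0 != 0) &&
           ((c *: val (root_signal p')) 0 ord_max != 0).
  have /andP[y0 yN] := valP (root_signal p').
  by apply/andP; split; rewrite mxE mulf_neq0.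
pose x' : signal R N :=
  exist (fun x : 'rV_N.+1 => (x 0 ord0 != 0) && (x 0 ord_max != 0)) _ x'P.
exists (root_signal p), x', x1, x2; split => /=.
- congr (_, _); apply/eqmodP/asboolP; by exists c.
- apply: (can_inj rVpolyK); rewrite rVpoly_conv // x1E x2E PQ.
  exact: rVpoly_root_signal.
- apply: (can_inj rVpolyK); rewrite rVpoly_conv // x1E conj_rVpoly_reflect_conj.
  by rewrite x2E PQ' linearZ /=; congr (_ *: _); exact: rVpoly_root_signal.
Qed.

Lemma conv_sub_component (R : realType) (N k : nat) (hk : (k <= N)%N)
    (S : {set 'I_N}) (hS : #|S| = (N - k)%N) (x x' : signal R N)
    (x1 : 'rV[R[i]]_k.+1) (x2 : 'rV[R[i]]_(N - k).+1) :
  val x = conv N x1 x2 -> val x' = conv N x1 (reflect_conj x2) ->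
  component S (\pi_(sigX R N) x, \pi_(sigX R N) x').
Proof.
move=> /(congr1 rVpoly) xE /(congr1 rVpoly) x'E.
have kmN : (k + (N - k))%N = N by rewrite subnKC.
have hSC : #|~: S| = k by rewrite cardsCs finset.setCK hS card_ord subKn.
move: xE x'E; rewrite !rVpoly_conv // conj_rVpoly_reflect_conj.
have : (size (rVpoly x1) <= k.+1)%N by exact: size_poly.
have : (size (map_poly Num.conj (rVpoly x2)) <= (N - k).+1)%N.
  by rewrite size_map_poly; exact: size_poly.
move: (rVpoly x1) (map_poly _ _) => P Q sQ sP xE x'E.
have size_x : size (rVpoly (val x)) = N.+1.
  apply/eqP; rewrite eqn_leq size_poly ltnNge.
  apply/negP => /leq_sizeP /(_ N (leqnn _)).
  rewrite -[N]/(val (@ord_max N)) coef_rVpoly_ord => /eqP.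
  by case/andP: (valP x) => _ /negPf ->.
have PQ0 : P * Q != 0 by rewrite -xE -size_poly_eq0 size_x.
have [P0 Q0] : P != 0 /\ Q != 0 by apply/andP; rewrite -negb_or -mulf_eq0.
have := size_x; rewrite xE size_mul // => sPQ.
(* Full support makes [P * Q] of degree exactly [N], so both size bounds are attained and the
   factors have exactly [k] and [N - k] roots. *)
have {sPQ} [szP szQ] : size P = k.+1 /\ size Q = (N - k).+1.
  have sizes (a b : nat) : (a <= k.+1)%N -> (b <= (N - k).+1)%N ->
      (a + b).-1 = N.+1 -> a = k.+1 /\ b = (N - k).+1 by lia.
  exact: sizes sP sQ sPQ.
have [rP PE] := closed_field_poly_normal P.
have [rQ QE] := closed_field_poly_normal Q.
have srP : size rP = #|~: S|.
  apply: succn_inj.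
  by rewrite hSC -szP PE size_scale ?lead_coef_eq0 // size_prod_XsubC.
have srQ : size rQ = #|S|.
  apply: succn_inj.
  by rewrite hS -szQ QE size_scale ?lead_coef_eq0 // size_prod_XsubC.
(* One family [b] lists the roots of [Q] along [S] and those of [P] along the complement. *)
have [b [bQ bP]] := exists_map_enum srQ srP.
move: PE QE; rewrite -bP -bQ !big_map => PE QE.
have [|p [pb Phip]] := @factored_signalP R N x (lead_coef P * lead_coef Q) b.
  rewrite xE {1}PE {1}QE -scalerAl -scalerAr scalerA.
  by rewrite (prod_enum_setC S).
have b0 i : b i != 0 by rewrite -pb; exact: (valP (p.2 i)).
pose b' i := if i \in S then ((b i)^*%R)^-1 else b i.
have bS i : i \in S -> b' i = ((b i)^*%R)^-1 by rewrite /b' => ->.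
have bSC i : i \notin S -> b' i = b i by rewrite /b' => /negPf ->.
have [|p' [pb' Phip']] := @factored_signalP R N x'
    (lead_coef P * ((lead_coef Q)^*%R * \prod_(i <- enum S) - ((b i)^*)%R)) b'.
  rewrite x'E {1}PE {1}QE -hS -scalerAl (mul_conj_recip_prod _ b0 bS bSC).
  by rewrite scalerA.
exists (p, p'); last by rewrite /= Phip Phip'.
split=> [i iS|i iS|w w1] /=.
- by rewrite pb pb' bS.
- by rewrite pb pb' bSC.
(* Equality of intensities is the invariance of the modulus of [Q] under reversal on the circle. *)
rewrite Phip Phip' !intensity_pi !dtft_rVpoly xE x'E !hornerM !normrM.
by rewrite norm_horner_conj_recip.
Qed.

Theorem theorem4p8 (R : realType) (N k : nat) (hk : (k <= N)%N)
    (S : {set 'I_N}) (hS : #|S| = (N - k)%N) :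
  @component R N S =
  [set q : sigX R N * sigX R N |
    exists (x x' : signal R N)
           (x1 : 'rV[R[i]]_k.+1) (x2 : 'rV[R[i]]_(N - k).+1),
      [/\ q = (\pi_(sigX R N) x, \pi_(sigX R N) x'),
          val x = conv N x1 x2
        & val x' = conv N x1 (reflect_conj x2)]].
Proof.
apply/seteqP; split=> [_ [[p p'] Ip <-]|_ [x [x' [x1 [x2 [-> xE x'E]]]]]].
  exact: (component_sub_conv hk hS Ip).
exact: (conv_sub_component hk hS xE x'E).
Qed.
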